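(* Let $d\ge 3$ be an odd integer. The group $G_d$ is very strongly fractal.
   Context: Let $d\ge 3$ be odd and $X=\{1,\dots,d\}$. Let $T$ be the $d$-regular rooted tree whose vertex set is the set $X^*$ of finite words over $X$, with root the empty word, the children of $u$ being $ux$, $x\in X$; $X^k$ is the $k$-th level. $\mathrm{Aut}(T)$ is the group of root-preserving graph automorphisms of $T$, with product $gh(u)=h(g(u))$ and identity $e$. For $g\in\mathrm{Aut}(T)$ and $u\in X^*$, the section $g|_u\in\mathrm{Aut}(T)$ is determined by $g(uv)=g(u)\,g|_u(v)$ for all $v\in X^*$. The wreath recursion of $g$ is $g=(g|_1,\dots,g|_d)\lambda_g$, where $\lambda_g\in S_d$ is the permutation induced by $g$ on $X$; it determines $g$. The group $G_d\le \mathrm{Aut}(T)$ is generated by $A=\{a_1,\dots,a_d\}$, defined recursively by: for $1\le i\le d-1$, $\lambda_{a_i}=(i\ \,i+1)$, $a_i|_i=a_i$, $a_i|_{i+1}=a_{i+1}$, and $a_i|_x=e$ for all other $x\in X$; and $\lambda_{a_d}=(d\ 1)$, $a_d|_1=a_1$, $a_d|_d=a_d$, and $a_d|_x=e$ for all other $x\in X$. For $G\le\mathrm{Aut}(T)$, $\mathrm{St}_G(\widehat{k})$ is the subgroup of elements of $G$ fixing every vertex of $X^k$ (so $\mathrm{St}_G(\widehat{0})=G$). $G$ is self-similar if $g|_u\in G$ for all $g\in G$, $u\in X^*$. For a vertex $u$, $\pi_u:\mathrm{St}_G(u)\to G$ is the homomorphism $\pi_u(g)=g|_u$ on the stabilizer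 of $u$. A self-similar group $G$ acting transitively on each level $X^k$ is very strongly fractal if $\pi_x(\mathrm{St}_G(\widehat{k+1}))=\mathrm{St}_G(\widehat{k})$ for all integers $k\ge 0$ and all $x\in X$. *)

(* Defs.v *)
From HB Require Import structures.
From mathcomp Require Import all_boot all_fingroup.
From mathcomp Require Import boolp classical_sets.

Set Implicit Arguments.
Unset Strict Implicit.
Unset Printing Implicit Defensive.

Local Open Scope group_scope.
Local Open Scope classical_set_scope.

(* The regular rooted tree has vertex set [seq X] and root [[::]]; the children
   of [u] are the words [rcons u x]. *)
Definition tree_edge (X : finType) : rel (seq X) :=
  fun u v => [exists x, v == rcons u x] || [exists x, u == rcons v x].

Definition is_tree_aut (X : finType) (f : seq X -> seq X) : Prop :=
  [/\ bijective f, f [::] = [::]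
    & forall u v, tree_edge (f u) (f v) = tree_edge u v].

Record tree_aut (X : finType) := TreeAut {
  tree_aut_fun :> seq X -> seq X;
  tree_autP : is_tree_aut tree_aut_fun
}.

Lemma tree_aut_eq (X : finType) (g h : tree_aut X) : g =1 h -> g = h.
Proof.
case: g h => [f fP] [f' f'P] /= /funext ff'; case: _ / ff' in f'P *.
by rewrite (Prop_irrelevance fP f'P).
Qed.

Lemma tree_aut_inj (X : finType) (g : tree_aut X) : injective g.
Proof. by case: (tree_autP g) => /bij_inj. Qed.

Lemma tree_aut_nil (X : finType) (g : tree_aut X) : g [::] = [::].
Proof. by case: (tree_autP g). Qed.

Lemma is_tree_aut_id (X : finType) : is_tree_aut (@id (seq X)).
Proof. by split=> //; exists id. Qed.

Lemma is_tree_aut_comp (X : finType) (f h : seq X -> seq X) :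
  is_tree_aut f -> is_tree_aut h -> is_tree_aut (h \o f).
Proof.
move=> [bf f0 ef] [bh h0 eh]; split=> [||u v] /=; first exact: bij_comp.
  by rewrite f0.
by rewrite eh ef.
Qed.

Lemma is_tree_aut_can (X : finType) (f h : seq X -> seq X) :
  is_tree_aut f -> cancel f h -> cancel h f -> is_tree_aut h.
Proof.
move=> [_ f0 ef] fK hK; split=> [||u v]; first by exists f.
  by rewrite -[in LHS]f0 fK.
by rewrite -ef !hK.
Qed.

Lemma tree_aut_inv_subproof (X : finType) (g : tree_aut X) :
  exists h : tree_aut X, cancel g h /\ cancel h g.
Proof.
have gP := tree_autP g; have [[h gK hK] _ _] := gP.
by exists (TreeAut (is_tree_aut_can gP gK hK)).
Qed.

Definition tree_aut_one (X : finType) : tree_aut X :=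
  TreeAut (is_tree_aut_id X).

(* Products compose from left to right: [(g * h) u = h (g u)]. *)
Definition tree_aut_mul (X : finType) (g h : tree_aut X) : tree_aut X :=
  TreeAut (is_tree_aut_comp (tree_autP g) (tree_autP h)).

Definition tree_aut_inv (X : finType) (g : tree_aut X) : tree_aut X :=
  sval (cid (tree_aut_inv_subproof g)).

Lemma tree_aut_invK (X : finType) (g : tree_aut X) : cancel g (tree_aut_inv g).
Proof. by rewrite /tree_aut_inv; case: cid => h []. Qed.

Lemma tree_aut_Kinv (X : finType) (g : tree_aut X) : cancel (tree_aut_inv g) g.
Proof. by rewrite /tree_aut_inv; case: cid => h []. Qed.

Lemma tree_aut_mulA (X : finType) : associative (@tree_aut_mul X).
Proof. by move=> g h k; apply: tree_aut_eq. Qed.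

Lemma tree_aut_mul1g (X : finType) :
  left_id (tree_aut_one X) (@tree_aut_mul X).
Proof. by move=> g; apply: tree_aut_eq. Qed.

Lemma tree_aut_mulg1 (X : finType) :
  right_id (tree_aut_one X) (@tree_aut_mul X).
Proof. by move=> g; apply: tree_aut_eq. Qed.

Lemma tree_aut_mulVg (X : finType) :
  left_inverse (tree_aut_one X) (@tree_aut_inv X) (@tree_aut_mul X).
Proof. by move=> g; apply: tree_aut_eq => u /=; rewrite tree_aut_Kinv. Qed.

Lemma tree_aut_mulgV (X : finType) :
  right_inverse (tree_aut_one X) (@tree_aut_inv X) (@tree_aut_mul X).
Proof. by move=> g; apply: tree_aut_eq => u /=; rewrite tree_aut_invK. Qed.

HB.instance Definition _ (X : finType) := gen_eqMixin (tree_aut X).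
HB.instance Definition _ (X : finType) := gen_choiceMixin (tree_aut X).
HB.instance Definition _ (X : finType) :=
  isGroup.Build (tree_aut X) (@tree_aut_mulA X) (@tree_aut_mul1g X)
    (@tree_aut_mulg1 X) (@tree_aut_mulVg X) (@tree_aut_mulgV X).

Lemma tree_edge_cat (X : finType) (u v w : seq X) :
  tree_edge (u ++ v) (u ++ w) = tree_edge v w.
Proof.
rewrite /tree_edge; congr (_ || _); apply: eq_existsb => x;
  by rewrite rcons_cat eqseq_cat // eqxx.
Qed.

Lemma tree_aut_rcons (X : finType) (g : tree_aut X) (u : seq X) (x : X) :
  exists y, g (rcons u x) = rcons (g u) y.
Proof.
have edge_rcons w z : tree_edge (g w) (g (rcons w z)).
  have [_ _ ->] := tree_autP g.
  by apply/orP; left; apply/existsP; exists z.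
elim/last_ind: u x => [|u z IHu] x.
  case/orP: (edge_rcons [::] x) => /existsP[y /eqP E]; first by exists y.
  by move: E; rewrite tree_aut_nil; case: (g _).
case/orP: (edge_rcons (rcons u z) x) => /existsP[y /eqP E]; first by exists y.
have [t /= Et] := IHu z; move: E; rewrite Et => /rcons_inj[/tree_aut_inj E _].
move/(congr1 size): E; rewrite !size_rcons => /eqP.
by rewrite eqn_leq ltnNge leqnSn andbF.
Qed.

Lemma size_tree_aut (X : finType) (g : tree_aut X) (u : seq X) :
  size (g u) = size u.
Proof.
elim/last_ind: u => [|u x IHu]; first by rewrite tree_aut_nil.
by have [y ->] := tree_aut_rcons g u x; rewrite !size_rcons IHu.
Qed.

Definition section_fun (X : finType) (g : tree_aut X) (u v : seq X) : seq X :=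
  drop (size u) (g (u ++ v)).

Lemma section_funE (X : finType) (g : tree_aut X) (u v : seq X) :
  g (u ++ v) = g u ++ section_fun g u v.
Proof.
rewrite /section_fun; elim/last_ind: v => [|v x IHv].
  by rewrite cats0 drop_oversize ?cats0 // size_tree_aut.
rewrite -rcons_cat; have [y ->] := tree_aut_rcons g (u ++ v) x.
rewrite drop_rcons ?size_tree_aut ?size_cat ?leq_addr //.
by rewrite -rcons_cat -IHv.
Qed.

Lemma is_tree_aut_section (X : finType) (g : tree_aut X) (u : seq X) :
  is_tree_aut (section_fun g u).
Proof.
split=> [||v w]; last first.
- have [_ _ eg] := tree_autP g.
  by rewrite -(tree_edge_cat (g u)) -!section_funE eg tree_edge_cat.
- by rewrite /section_fun cats0 drop_oversize // size_tree_aut.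
set h := tree_aut_inv g.
have gK : cancel g h := tree_aut_invK g.
have hK : cancel h g := tree_aut_Kinv g.
have cat_inj w : injective (cat w : seq X -> seq X).
  by move=> s t /(congr1 (drop (size w))); rewrite !drop_size_cat.
exists (section_fun h (g u)) => v.
  by apply: (@cat_inj u); rewrite -{1}(gK u) -section_funE -section_funE gK.
apply: (@cat_inj (g u)); rewrite -section_funE.
by rewrite -{1}(gK u) -section_funE hK.
Qed.

(* The section of [g] at [u], characterized by [sectionE] below. *)
Definition tree_section (X : finType) (g : tree_aut X) (u : seq X) : tree_aut X :=
  TreeAut (is_tree_aut_section g u).

Lemma sectionE (X : finType) (g : tree_aut X) (u v : seq X) :
  g (u ++ v) = g u ++ tree_section g u v.
Proof. exact: section_funE. Qed.

Lemma section_mul (X : finType) (g h : tree_aut X) (u : seq X) :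
  tree_section (g * h) u = tree_section g u * tree_section h (g u).
Proof.
apply: tree_aut_eq => v.
suff /(congr1 (drop (size u))) : (g * h) u ++ tree_section (g * h) u v =
    (g * h) u ++ (tree_section g u * tree_section h (g u)) v.
  by rewrite !drop_size_cat ?size_tree_aut.
by rewrite -sectionE /= sectionE sectionE.
Qed.

Definition is_subgroup (X : finType) (H : set (tree_aut X)) : Prop :=
  group_closed [in H].

Definition subgroup_generated (X : finType) (A : set (tree_aut X)) : set (tree_aut X) :=
  smallest (@is_subgroup X) A.

Definition level_stab (X : finType) (G : set (tree_aut X)) (k : nat) :
    set (tree_aut X) :=
  [set g | G g /\ forall u : seq X, size u = k -> g u = u].

Definition self_similar (X : finType) (G : set (tree_aut X)) : Prop :=
  forall g u, G g -> G (tree_section g u).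

Definition level_transitive (X : finType) (G : set (tree_aut X)) : Prop :=
  forall (k : nat) (u v : seq X), size u = k -> size v = k ->
    exists2 g, G g & g u = v.

Definition very_strongly_fractal (X : finType) (G : set (tree_aut X)) : Prop :=
  [/\ is_subgroup G, self_similar G, level_transitive G
    & forall (k : nat) (x : X),
        [set tree_section g [:: x] | g in level_stab G k.+1] = level_stab G k].

(* Over the alphabet ['I_d = {0, ..., d-1}] (letters shifted by one), [ordS] is
   the cyclic successor, so that [ordS (d-1) = 0]; hence the wreath recursion
   of [a_d] has the same shape as that of the other generators. *)
Fixpoint gen_fun (d : nat) (i : 'I_d) (w : seq 'I_d) : seq 'I_d :=
  if w is x :: v then
    tperm i (ordS i) x ::
      (if x == i then gen_fun i v
       else if x == ordS i then gen_fun (ordS i) v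
       else v)
  else [::].

Fixpoint gen_inv_fun (d : nat) (i : 'I_d) (w : seq 'I_d) : seq 'I_d :=
  if w is y :: v then
    let x := tperm i (ordS i) y in
    x :: (if x == i then gen_inv_fun i v
          else if x == ordS i then gen_inv_fun (ordS i) v
          else v)
  else [::].

Lemma gen_funK (d : nat) (i : 'I_d) : cancel (gen_fun i) (gen_inv_fun i).
Proof.
move=> w; elim: w i => [//|x v IHv] i /=; rewrite tpermK; congr (_ :: _).
by case: (x == i) => //; case: (x == ordS i).
Qed.

Lemma gen_inv_funK (d : nat) (i : 'I_d) : cancel (gen_inv_fun i) (gen_fun i).
Proof.
move=> w; elim: w i => [//|y v IHv] i /=; rewrite tpermK; congr (_ :: _).
by case: (_ == i) => //; case: (_ == ordS i).
Qed.

Lemma gen_fun_rcons (d : nat) (i : 'I_d) (u : seq 'I_d) (x : 'I_d) :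
  exists y, gen_fun i (rcons u x) = rcons (gen_fun i u) y.
Proof.
elim: u i => [|z u IHu] i /=; first by exists (tperm i (ordS i) x);
  rewrite !if_same.
case: ifP => _; first by have [y ->] := IHu i; exists y.
by case: ifP => _; [have [y ->] := IHu (ordS i); exists y | exists x].
Qed.

Lemma gen_inv_fun_rcons (d : nat) (i : 'I_d) (u : seq 'I_d) (x : 'I_d) :
  exists y, gen_inv_fun i (rcons u x) = rcons (gen_inv_fun i u) y.
Proof.
elim: u i => [|z u IHu] i /=; first by exists (tperm i (ordS i) x);
  rewrite !if_same.
case: ifP => _; first by have [y ->] := IHu i; exists y.
by case: ifP => _; [have [y ->] := IHu (ordS i); exists y | exists x].
Qed.

Lemma is_tree_aut_gen (d : nat) (i : 'I_d) : is_tree_aut (gen_fun i).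
Proof.
have edge_homo (f : seq 'I_d -> seq 'I_d) :
    (forall u x, exists y, f (rcons u x) = rcons (f u) y) ->
    {homo f : u v / tree_edge u v}.
  move=> fr u v /orP[]/existsP[x /eqP->].
    by have [y ->] := fr u x; apply/orP; left; apply/existsP; exists y.
  by have [y ->] := fr v x; apply/orP; right; apply/existsP; exists y.
split=> [||u v] //.
  exact: Bijective (@gen_funK d i) (@gen_inv_funK d i).
apply/idP/idP; last by move/(edge_homo _ (@gen_fun_rcons d i)).
by move/(edge_homo _ (@gen_inv_fun_rcons d i)); rewrite !gen_funK.
Qed.

Definition G_gen (d : nat) (i : 'I_d) : tree_aut 'I_d :=
  TreeAut (is_tree_aut_gen i).

Lemma gen_letter (d : nat) (i x : 'I_d) :
  G_gen i [:: x] = [:: tperm i (ordS i) x].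
Proof. by rewrite /= !if_same. Qed.

Lemma gen_section (d : nat) (i x : 'I_d) :
  tree_section (G_gen i) [:: x] =
    if x == i then G_gen i else if x == ordS i then G_gen (ordS i) else 1.
Proof.
apply: tree_aut_eq => v; rewrite /= /section_fun /= drop0.
by case: (x == i) => //; case: (x == ordS i).
Qed.

Definition G_ (d : nat) : set (tree_aut 'I_d) :=
  subgroup_generated [set G_gen i | i in [set: 'I_d]].
Arguments G_ : clear implicits.

(* Main.v *)
Require Import Defs.
From mathcomp Require Import all_boot.
From mathcomp Require Import all_fingroup.
From mathcomp Require Import zify.
From mathcomp Require Import boolp classical_sets.

(** Write [a i] for the generators and [ordS] for the cyclic successor on
    letters. Everything rests on one feature of the recursion: a letter [x] is
    moved by exactly two generators, and both have the same section [a x]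
    there.

    Let [K x] be the set of [g] such that the automorphism acting as [g] below
    the letter [x], and trivially elsewhere, belongs to the group (predicate
    [rigid]). Conjugating by the two generators that move the middle of three
    consecutive letters gives [K x = K (x+2)]; since [d] is odd, all the [K x]
    are one and the same subgroup [K], and [K] is normal ([rigid_eq],
    [rigidJG]). Comparing the two sides of the braid relation between
    neighbouring generators, whose sections agree except at one letter, yields
    [a i = a (i+2)] modulo [K] ([rigid_braid]); again because [d] is odd, all
    generators are equal modulo [K] ([gen_eqmod]). So the quotient by [K] is
    cyclic, and an alternating product of squares of generators shows that
    fourth powers of generators lie in [K] ([rigid_gen4], [G_eqmod_gen]).

    On the other hand, going once around the cycle of letters produces an
    element [h] that fixes every letter and whose section at [x] is [a x ^+ d]
    modulo [K] ([odd_loop]). Let [g] be in the group, equal to [a x ^+ m]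
    modulo [K]. As [d * d] is 1 modulo 4, the power [h ^+ (d * m)] has section
    [g] at [x] modulo [K]; each of its other sections is, modulo [K], a power
    of [g]. An error in [K] can be corrected at each letter separately, hence
    the group contains an element fixing all letters, whose section at [x] is
    exactly [g] and whose other sections are powers of [g]
    ([G_level1_tuple_extend]). If [g] fixes level [k], so do its powers, and
    that element fixes level [k + 1]: this is very strong fractality
    ([G_fractal]). Level transitivity follows from the case [k = 0] and
    transitivity on letters. *)

Set Implicit Arguments.
Unset Strict Implicit.
Unset Printing Implicit Defensive.

(** * Subgroups of the automorphism group of the tree *)

Section Subgroups.
Local Open Scope group_scope.
Local Open Scope classical_set_scope.
Variables (X : finType) (H : set (tree_aut X)).

Lemma is_subgroup_intro :
  H 1 -> (forall g h, H g -> H h -> H (g * h)) -> (forall g, H g -> H g^-1) ->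
  is_subgroup H.
Proof.
move=> H1 HM HV; split=> [|g h]; rewrite !inE //.
by move=> Hg Hh; apply: HM => //; apply: HV.
Qed.

Hypothesis sgH : is_subgroup H.

Lemma subgroup1 : H 1.
Proof. by case: sgH; rewrite inE. Qed.

Lemma subgroupV g : H g -> H g^-1.
Proof.
by move=> Hg; have := group_closedV sgH; move/(_ g); rewrite !inE; apply.
Qed.

Lemma subgroupM g h : H g -> H h -> H (g * h).
Proof.
move=> Hg Hh; have := group_closedM sgH.
by move/(_ g h); rewrite !inE; apply.
Qed.

Lemma subgroupX g n : H g -> H (g ^+ n).
Proof.
move=> Hg; elim: n => [|n IHn]; first by rewrite expg0; apply: subgroup1.
by rewrite expgS; apply: subgroupM.
Qed.

Lemma subgroupJ g h : H g -> H h -> H (g ^ h).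
Proof.
by move=> Hg Hh; apply: subgroupM; [apply: subgroupV | apply: subgroupM].
Qed.

End Subgroups.

(** * Wreath recursion and elements supported below one letter *)

Section WreathRecursion.
Local Open Scope group_scope.
Local Open Scope classical_set_scope.
Variable X : finType.
Implicit Types (g h : tree_aut X) (x y : X).

Definition letter_act g x : X := head x (g [:: x]).
Definition letter_section g x : tree_aut X := tree_section g [:: x].

Lemma letter_actE g x : g [:: x] = [:: letter_act g x].
Proof.
have := size_tree_aut g [:: x]; rewrite /letter_act.
by case: (g _) => [|y []].
Qed.

Lemma letter_sectionE g x v :
  g (x :: v) = letter_act g x :: letter_section g x v.
Proof. by rewrite -cat1s sectionE letter_actE. Qed.

Lemma letter_section1 x : letter_section 1 x = 1.
Proof. by apply: tree_aut_eq => v /=; rewrite /section_fun /= drop0. Qed.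

Lemma letter_actM g h x : letter_act (g * h) x = letter_act h (letter_act g x).
Proof. by rewrite {1}/letter_act /= letter_actE letter_actE. Qed.

Lemma letter_sectionM g h x :
  letter_section (g * h) x =
  letter_section g x * letter_section h (letter_act g x).
Proof. by rewrite /letter_section section_mul letter_actE. Qed.

Lemma letter_actK g x : letter_act g^-1 (letter_act g x) = x.
Proof. by rewrite -letter_actM mulgV. Qed.

Lemma letter_actKV g x : letter_act g (letter_act g^-1 x) = x.
Proof. by rewrite -letter_actM mulVg. Qed.

Lemma letter_sectionV g x :
  letter_section g^-1 (letter_act g x) = (letter_section g x)^-1.
Proof.
apply: (mulgI (letter_section g x)).
by rewrite -letter_sectionM !mulgV letter_section1.
Qed.

Lemma letter_actJ g h x :
  letter_act (g ^ h) (letter_act h x) = letter_act h (letter_act g x).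
Proof. by rewrite conjgE !letter_actM letter_actK. Qed.

Lemma letter_sectionJ g h x : letter_act g x = x ->
  letter_section (g ^ h) (letter_act h x) =
  letter_section g x ^ letter_section h x.
Proof.
move=> gx; rewrite conjgE !letter_sectionM letter_sectionV letter_actK gx.
by rewrite -conjgE.
Qed.

Lemma letter_sectionF g h x : letter_act g x = letter_act h x ->
  letter_section (g * h^-1) x = letter_section g x * (letter_section h x)^-1.
Proof. by move=> gh; rewrite letter_sectionM gh letter_sectionV. Qed.

Variable H : set (tree_aut X).
Hypothesis sgH : is_subgroup H.

(** The image in the direct power, under the wreath recursion, of the
    stabilizer in [H] of the first level. *)
Definition level1_tuple (f : X -> tree_aut X) : Prop :=
  exists2 h, H h & forall x, letter_act h x = x /\ letter_section h x = f x.

Lemma eq_level1_tuple f f' : f =1 f' -> level1_tuple f -> level1_tuple f'.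
Proof. by move=> ff' [h Hh hf]; exists h => // x; rewrite -ff'. Qed.

Lemma level1_tuple1 : level1_tuple (fun=> 1).
Proof.
by exists 1 => [|x]; [apply: subgroup1 | rewrite letter_section1].
Qed.

Lemma level1_tupleM f f' :
  level1_tuple f -> level1_tuple f' -> level1_tuple (fun x => f x * f' x).
Proof.
move=> [h Hh hf] [h' Hh' hf']; exists (h * h'); first exact: subgroupM.
move=> x; rewrite letter_actM letter_sectionM.
by have [-> ->] := hf x; have [-> ->] := hf' x.
Qed.

Lemma level1_tupleV f : level1_tuple f -> level1_tuple (fun x => (f x)^-1).
Proof.
move=> [h Hh hf]; exists h^-1; first exact: subgroupV.
move=> x; have [hx <-] := hf x; rewrite -{1 3}hx letter_actK.
by rewrite letter_sectionV.
Qed.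

Lemma level1_tupleJ f s : H s -> level1_tuple f ->
  level1_tuple (fun y => let x := letter_act s^-1 y in
                         f x ^ letter_section s x).
Proof.
move=> Hs [h Hh hf]; exists (h ^ s); first exact: subgroupJ.
move=> y /=; set x := letter_act s^-1 y.
rewrite -(letter_actKV s y) -/x; have [hx <-] := hf x.
by rewrite letter_actJ hx letter_sectionJ.
Qed.

(** The sections at [x] of the rigid stabilizer of [x] in [H]. *)
Definition rigid (x : X) (g : tree_aut X) : Prop :=
  level1_tuple (fun y => if y == x then g else 1).

Lemma rigid1 x : rigid x 1.
Proof. by apply: eq_level1_tuple level1_tuple1 => y; rewrite if_same. Qed.

Lemma rigidM x g h : rigid x g -> rigid x h -> rigid x (g * h).
Proof.
move=> Kg Kh; apply: eq_level1_tuple (level1_tupleM Kg Kh) => y.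
by case: eqP; rewrite ?mulg1.
Qed.

Lemma rigidV x g : rigid x g -> rigid x g^-1.
Proof.
move=> Kg; apply: eq_level1_tuple (level1_tupleV Kg) => y.
by case: eqP; rewrite ?invg1.
Qed.

(** Conjugation by an element of [H] that does not fix [x] carries rigid
    sections from one letter to another. *)
Lemma rigidJ s x g : H s -> rigid x g ->
  rigid (letter_act s x) (g ^ letter_section s x).
Proof.
move=> Hs Kg; apply: eq_level1_tuple (level1_tupleJ Hs Kg) => y /=.
have -> : (y == letter_act s x) = (letter_act s^-1 y == x).
  by apply/eqP/eqP => [->|<-]; rewrite ?letter_actK ?letter_actKV.
by case: eqP => [->|_]; rewrite ?conj1g.
Qed.

(** Being the tuple of sections of an element of [H] only depends on the
    entries modulo the rigid sections, because the corrections at different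
    letters are independent of each other. *)
Lemma level1_tuple_mod f f' : level1_tuple f ->
  (forall x, rigid x ((f x)^-1 * f' x)) -> level1_tuple f'.
Proof.
move=> Hf Kff'; pose g x := (f x)^-1 * f' x.
(* Replace the entries of [f] one letter at a time. *)
have Hg (r : seq X) :
    uniq r -> level1_tuple (fun x => if x \in r then g x else 1).
  elim: r => [_|z r IHr /= /andP[zr /IHr Hr]]; first exact: level1_tuple1.
  apply: eq_level1_tuple (level1_tupleM (Kff' z) Hr) => x.
  rewrite inE; case: eqP => [->|_] /=; last by rewrite mul1g.
  by rewrite (negPf zr) mulg1.
apply: eq_level1_tuple (level1_tupleM Hf (Hg _ (enum_uniq X))) => x.
by rewrite mem_enum mulVKg.
Qed.

End WreathRecursion.

(** * The group and its action on letters *)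

Section TheGroup.
Local Open Scope group_scope.
Local Open Scope classical_set_scope.
Variable d : nat.
Hypotheses (d_ge3 : 3 <= d) (d_odd : odd d).
Implicit Types (i j x y : 'I_d) (g h : tree_aut 'I_d).
Notation a := (@G_gen d).
Notation G := (G_ d).

Lemma G_subgroup : is_subgroup G.
Proof.
apply: is_subgroup_intro => [|g h Gg Gh|g Gg] P [sgP genP].
- exact: subgroup1 sgP.
- by apply: (subgroupM sgP); [apply: Gg | apply: Gh].
- by apply: (subgroupV sgP); apply: Gg.
Qed.
Let sgG := G_subgroup.

Lemma G_gen_in i : G (a i).
Proof. by apply: sub_gen_smallest; exists i. Qed.

Lemma G_ind (P : tree_aut 'I_d -> Prop) : P 1 ->
  (forall g h, P g -> P h -> P (g * h)) -> (forall g, P g -> P g^-1) ->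
  (forall i, P (a i)) -> forall g, G g -> P g.
Proof.
move=> P1 PM PV Pa; apply: smallest_sub; first exact: is_subgroup_intro.
by move=> _ [i _ <-].
Qed.

Lemma G_self_similar : self_similar G.
Proof.
have Gsec g : G g -> forall x, G (letter_section g x).
  move: g; apply: G_ind => [x|g h Gg Gh x|g Gg x|i x].
  - by rewrite letter_section1; apply: subgroup1 sgG.
  - by rewrite letter_sectionM; apply: (subgroupM sgG).
  - rewrite -(letter_actKV g x) letter_sectionV.
    exact: (subgroupV sgG).
  rewrite /letter_section gen_section.
  by do 2?[case: ifP => _]; [apply: G_gen_in.. | apply: subgroup1 sgG].
move=> g u; elim: u g => [|x u IHu] g Gg.
  suff -> : tree_section g [::] = g by [].
  by apply: tree_aut_eq => v; rewrite /= /section_fun drop0.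
suff -> : tree_section g (x :: u) = tree_section (letter_section g x) u.
  by apply: IHu; apply: Gsec.
by apply: tree_aut_eq => v; rewrite /= /section_fun cat_cons letter_sectionE.
Qed.

Lemma iter_ordS_val n i : iter n (@ordS d) i = (i + n) %% d :> nat.
Proof.
elim: n => [|n IHn]; first by rewrite addn0 modn_small.
by rewrite iterS /= IHn addnS -[in LHS]addn1 modnDml addn1.
Qed.

Lemma iter_ordS_d i : iter d (@ordS d) i = i.
Proof. by apply: val_inj; rewrite /= iter_ordS_val modnDr modn_small. Qed.

Lemma iter_ordS_neq n i : 0 < n < d -> iter n (@ordS d) i != i.
Proof.
case/andP=> n_gt0 n_lt; rewrite -val_eqE /= iter_ordS_val.
rewrite -[X in _ != X](modn_small (ltn_ord i)) -[X in _ == X %[mod d]]addn0.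
by rewrite eqn_modDl mod0n modn_small // -lt0n.
Qed.

Lemma ordS_neq i : ordS i != i.
Proof. by apply: (@iter_ordS_neq 1); rewrite (leq_trans _ d_ge3). Qed.

Lemma ordSS_neq i : ordS (ordS i) != i.
Proof. exact: (@iter_ordS_neq 2). Qed.

Lemma iter_ordS_surj i j : exists2 n, n < d & j = iter n (@ordS d) i.
Proof.
exists ((j + (d - i)) %% d); first by rewrite ltn_mod (leq_trans _ d_ge3).
apply: val_inj; rewrite /= iter_ordS_val modnDmr addnCA.
by rewrite subnKC 1?ltnW // modnDr modn_small.
Qed.

(** As [d] is odd, double steps reach every letter of the cycle. *)
Lemma ordSS_ind (P : 'I_d -> Prop) i j :
  (forall x, P x -> P (ordS (ordS x))) -> P i -> P j.
Proof.
move=> PSS; have P2n n x : P x -> P (iter n.*2 (@ordS d) x).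
  by move=> Px; elim: n => [|n IHn] //=; apply: PSS.
have [n n_lt ->] := iter_ordS_surj i j => Pi.
rewrite -[n]odd_double_half; case: (odd n); last exact: P2n.
rewrite -(iter_ordS_d i) -iterD.
have -> : true + n./2.*2 + d = (n./2 + d./2).+1.*2.
  by rewrite -{1}[d]odd_double_half d_odd addnACA -doubleD doubleS.
exact: P2n.
Qed.

Lemma gen_actE i x : letter_act (a i) x = tperm i (ordS i) x.
Proof. by rewrite /letter_act gen_letter. Qed.

Lemma gen_sectionE i x :
  letter_section (a i) x = if (x == i) || (x == ordS i) then a x else 1.
Proof.
rewrite /letter_section gen_section.
by case: eqP => [->|_] //=; case: eqP => [->|].
Qed.

(** * The normal subgroup of rigid sections *)

Notation K := (@rigid 'I_d G).

Lemma rigid_ordS i g : K i g -> K (ordS i) (g ^ a i).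
Proof.
move/(rigidJ sgG (G_gen_in i)).
by rewrite gen_actE tpermL gen_sectionE eqxx.
Qed.

Lemma rigid_unordS i g : K i g -> K (ordS i) (g ^ (a (ordS i))^-1).
Proof.
move/(rigidJ sgG (subgroupV sgG (G_gen_in i))).
have aS : letter_act (a i) (ordS i) = i by rewrite gen_actE tpermR.
have -> : letter_act (a i)^-1 i = ordS i by rewrite -{2}aS letter_actK.
suff -> : letter_section (a i)^-1 i = (a (ordS i))^-1 by [].
by rewrite -{2}aS letter_sectionV gen_sectionE eqxx orbT.
Qed.

(** The two generators moving [ordS x] have the same section there, so the
    step from [x] to [ordS x] and the step from [ordS x] to its successor twist
    by inverse conjugations. *)
Lemma rigid_eq i j g : K i g -> K j g.
Proof.
apply: (@ordSS_ind (fun x => K x g)) => x.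
by move/rigid_unordS/rigid_ordS; rewrite conjgKV.
Qed.

Lemma rigid_genJ j x y g : K x g -> K y (g ^ a j) /\ K y (g ^ (a j)^-1).
Proof.
move=> Kg; split; first exact: rigid_eq (rigid_ordS (rigid_eq j Kg)).
rewrite -[j]ord_predK.
exact: rigid_eq (rigid_unordS (rigid_eq (ord_pred j) Kg)).
Qed.

Lemma rigidJG x s g : G s -> K x g -> K x (g ^ s).
Proof.
pose P t := forall u y, K y u -> K y (u ^ t) /\ K y (u ^ t^-1).
suff GP : forall t, G t -> P t by move=> /GP Ps /Ps[].
apply: G_ind => [u y Ku|t t' Pt Pt' u y Ku|t Pt u y Ku|j u y].
- by rewrite invg1 conjg1.
- rewrite invMg !conjgM; split.
    by have [/Pt'[]] := Pt _ _ Ku.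
  by have [_ /Pt[]] := Pt' _ _ Ku.
- by have [] := Pt _ _ Ku; rewrite invgK.
- exact: rigid_genJ.
Qed.

Lemma gen_act_if i x : letter_act (a i) x =
  if x == i then ordS i else if x == ordS i then i else x.
Proof. by rewrite gen_actE permE. Qed.

(** Write [i], [j], [k] for three consecutive letters. The two sides
    [a i * a j * a i] and [a j * a i * a j] of the braid relation permute the
    letters in the same way and have the same sections, except at [j], where
    these are [a j * a i] and [a j * a k]. *)
Lemma rigid_braid i : K (ordS i)
  ((a i * (a (ordS (ordS i)))^-1) ^ (a (ordS i))^-1).
Proof.
set j := ordS i; set k := ordS j.
have neqs : ((i == j) = false) * ((j == i) = false) * ((j == k) = false) *
            ((k == j) = false) * ((i == k) = false) * ((k == i) = false).
  rewrite !(eq_sym i) !(eq_sym j k) !(negPf (ordS_neq _)).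
  by rewrite (negPf (ordSS_neq i)).
have actE x :
    letter_act (a i * a j * a i) x = letter_act (a j * a i * a j) x.
  rewrite !letter_actM !gen_act_if -/j -/k.
  case: (eqVneq x i) => [E|/negPf xi]; first by rewrite ?E !(eqxx, neqs).
  case: (eqVneq x j) => [E|/negPf xj]; first by rewrite ?E !(eqxx, neqs).
  case: (eqVneq x k) => [E|/negPf xk]; first by rewrite ?E !(eqxx, neqs).
  by rewrite !(xi, xj, xk).
have Ga x : G (a x) := G_gen_in x.
exists ((a i * a j * a i) * (a j * a i * a j)^-1).
  do !apply: (subgroupM sgG) => //; apply: (subgroupV sgG).
  by do !apply: (subgroupM sgG).
move=> x; split.
  by rewrite letter_actM actE letter_actK.
rewrite (letter_sectionF (actE x)).
rewrite !letter_sectionM !letter_actM !gen_act_if !gen_sectionE -/j -/k.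
case: (eqVneq x j) => [E|/negPf xj].
  rewrite ?E !(eqxx, neqs) /= conjgE.
  by rewrite ?invMg ?invgK ?invg1 ?mul1g ?mulg1 !mulgA.
case: (eqVneq x i) => [E|/negPf xi].
  by rewrite ?E !(eqxx, neqs) /= ?mul1g ?mulg1 mulgV.
case: (eqVneq x k) => [E|/negPf xk].
  by rewrite ?E !(eqxx, neqs) /= ?mul1g ?mulg1 mulgV.
by rewrite !(xi, xj, xk) /= ?mul1g ?mulg1 invg1.
Qed.

(** * The quotient by the rigid sections is cyclic of order dividing four *)

Definition rigid_eqmod g h : Prop := forall x, K x (g^-1 * h).
Notation "g ~ h" := (rigid_eqmod g h) (at level 70).

Lemma rigid_eqmodP x g h : K x (g^-1 * h) -> g ~ h.
Proof. by move=> Kgh y; apply: rigid_eq Kgh. Qed.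

Lemma rigid_eqmod_refl g : g ~ g.
Proof. by move=> x; rewrite mulVg; apply: (rigid1 sgG). Qed.

Lemma rigid_eqmod_sym g h : g ~ h -> h ~ g.
Proof. by move=> gh x; have := rigidV sgG (gh x); rewrite invMg invgK. Qed.

Lemma rigid_eqmod_trans h g k : g ~ h -> h ~ k -> g ~ k.
Proof.
by move=> gh hk x; have := rigidM sgG (gh x) (hk x); rewrite mulgA mulgK.
Qed.

Lemma rigid_eqmodM g g' h h' : G h -> g ~ g' -> h ~ h' -> g * h ~ g' * h'.
Proof.
move=> Gh gg' hh' x; have := rigidM sgG (rigidJG Gh (gg' x)) (hh' x).
by rewrite conjgE invMg !mulgA mulgK.
Qed.

Lemma rigid_eqmodV g g' : G g -> g ~ g' -> g^-1 ~ g'^-1.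
Proof.
move=> Gg gg' x.
have := rigidJG (subgroupV sgG Gg) (rigid_eqmod_sym gg' x).
by rewrite conjgE !invgK mulgK.
Qed.

Lemma rigid_eqmodX g g' n : G g -> g ~ g' -> g ^+ n ~ g' ^+ n.
Proof.
move=> Gg gg'; elim: n => [|n IHn]; first exact: rigid_eqmod_refl.
by rewrite !expgS; apply: rigid_eqmodM => //; apply: (subgroupX sgG).
Qed.

Lemma gen_eqmod i j : a i ~ a j.
Proof.
apply: (@ordSS_ind (fun y => a i ~ a y) i j _ (rigid_eqmod_refl _)) => x ix.
apply: (rigid_eqmod_trans ix).
have := rigidJG (G_gen_in (ordS x)) (rigid_braid x); rewrite conjgKV.
rewrite -{1}[a x]invgK => /rigid_eqmodP/rigid_eqmodV.
by rewrite !invgK => /(_ (subgroupV sgG (G_gen_in x))).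
Qed.

Lemma level1_tuple_eqmod f f' :
  level1_tuple G f -> (forall x, f x ~ f' x) -> level1_tuple G f'.
Proof.
by move=> Gf ff'; apply: (level1_tuple_mod sgG Gf) => x; apply: ff'.
Qed.

(** The square of [a x] has sections [a x * a (ordS x)] and
    [a (ordS x) * a x] at the two letters that [a x] exchanges, both equal to
    [a i ^+ 2] modulo rigid sections. *)
Lemma gen_sq_tuple i x : level1_tuple G
  (fun y => if (y == x) || (y == ordS x) then a i ^+ 2 else 1).
Proof.
have Ga y : G (a y) := G_gen_in y.
pose f y := if y == x then a x * a (ordS x)
            else if y == ordS x then a (ordS x) * a x else 1.
have Gf : level1_tuple G f.
  exists (a x * a x) => [|y]; first exact: (subgroupM sgG).
  rewrite letter_actM letter_sectionM !gen_act_if !gen_sectionE /f.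
  case: (eqVneq y x) => [E|/negPf xi].
    by rewrite ?E !eqxx (negPf (ordS_neq _)) orbT.
  case: (eqVneq y (ordS x)) => [E|/negPf xj]; first by rewrite ?E !eqxx.
  by rewrite xi xj mulg1.
apply: level1_tuple_eqmod Gf _ => y; rewrite expg2 /f.
have aa u v : a u * a v ~ a i * a i.
  by apply: rigid_eqmodM => //; apply: gen_eqmod.
by do 2!case: (_ == _) => //=; apply: rigid_eqmod_refl.
Qed.

(** With [c] the square of [a i], the group contains [c] placed at any two
    adjacent letters. Dividing two such elements that share a letter gives [c]
    at [x] and [c^-1] at [x+2]; as [d] is odd, chaining these quotients gives
    [c] at [i] and [c^-1] at any letter. Take [ordS i] for the latter and
    multiply by [c] at [i] and [ordS i]: only [c * c] at [i] is left. *)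
Lemma rigid_gen4 i : K i (a i ^+ 4).
Proof.
set c := a i ^+ 2.
pose f x y := if y == x then c else 1.
have Gsq x : level1_tuple G (fun y => f x y * f (ordS x) y).
  apply: eq_level1_tuple (gen_sq_tuple i x) => y; rewrite /f.
  case: (eqVneq y x) => [->|] /=; last by rewrite mul1g.
  by rewrite eq_sym (negPf (ordS_neq x)) mulg1.
have Gsq' x : level1_tuple G (fun y => f (ordS x) y * f x y).
  apply: eq_level1_tuple (Gsq x) => y; rewrite /f.
  by case: (y == x); case: (y == ordS x); rewrite ?(mulg1, mul1g).
have Gdiff x : level1_tuple G (fun y => f i y * (f x y)^-1).
  pose P x := level1_tuple G (fun y => f i y * (f x y)^-1).
  apply: (@ordSS_ind P i x) => [z Gz|].
    (* the factors of the second square are swapped so that they cancel *)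
    have Gzz := level1_tupleM sgG (Gsq z) (level1_tupleV sgG (Gsq' (ordS z))).
    apply: eq_level1_tuple (level1_tupleM sgG Gz Gzz) => y.
    by rewrite invMg !mulgA mulgVK mulgK.
  by apply: eq_level1_tuple (level1_tuple1 sgG) => y; rewrite mulgV.
apply: eq_level1_tuple (level1_tupleM sgG (Gdiff (ordS i)) (Gsq i)) => y.
rewrite /f; case: (eqVneq y i) => [->|_]; last by rewrite !mul1g mulVg.
by rewrite eq_sym (negPf (ordS_neq i)) invg1 !mulg1 -expgnDr.
Qed.

Lemma gen_exp_mod4 i m p : a i ^+ (m + 4 * p) ~ a i ^+ m.
Proof.
apply: rigid_eqmod_sym; apply: (@rigid_eqmodP i).
rewrite expgnDr mulKg expgnA; elim: p => [|p IHp]; first exact: rigid1.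
by rewrite expgS; apply: rigidM => //; apply: rigid_gen4.
Qed.

Lemma gen_expV i m : (a i ^+ m)^-1 ~ a i ^+ (m * 3).
Proof.
apply: (@rigid_eqmodP i); rewrite invgK -expgnDr -mulnS mulnC.
by have := rigid_eqmod_sym (gen_exp_mod4 i 0 m) i; rewrite invg1 mul1g.
Qed.

Lemma G_eqmod_gen i g : G g -> exists n, g ~ a i ^+ n.
Proof.
have Gai n : G (a i ^+ n) by apply: (subgroupX sgG); apply: G_gen_in.
pose P g := G g /\ exists n, g ~ a i ^+ n.
suff GP : forall g, G g -> P g by move/GP=> [].
apply: G_ind => [|g' h [Gg [m gm]] [Gh [n hn]]|g' [Gg [n gn]]|j].
- by split; [apply: subgroup1 sgG | exists 0; apply: rigid_eqmod_refl].
- split; first exact: (subgroupM sgG).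
  by exists (m + n); rewrite expgnDr; apply: rigid_eqmodM.
- split; first exact: (subgroupV sgG).
  exists (n * 3)%N; apply: rigid_eqmod_trans (rigid_eqmodV Gg gn) _.
  exact: gen_expV.
- by split; [apply: G_gen_in | exists 1%N; rewrite expg1; apply: gen_eqmod].
Qed.


(** * Elements fixing the first level with a prescribed section *)

(** Conjugating [a x] successively by the next generators gives elements that
    exchange [x] with the letter [n] steps further, with section [a x ^+ n] at
    [x]: each conjugation moves the image of [x] one step and appends the
    section of one more generator. After [d - 1] steps, the last generator
    brings that image back to [x] and undoes the transposition. *)
Lemma odd_loop x : exists h, [/\ G h, forall y, letter_act h y = y
  & letter_section h x ~ a x ^+ d].
Proof.
pose c n := iter n (@ordS d) x.
have Ga y : G (a y) := G_gen_in y.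
have walk n : n.+1 < d -> exists t, [/\ G t,
    forall y, letter_act t y = tperm x (c n.+1) y
    & letter_section t x ~ a x ^+ n.+1].
  elim: n => [_|n IHn n_lt].
    exists (a x); split=> [|y|]; first exact: Ga; first exact: gen_actE.
    by rewrite gen_sectionE eqxx; apply: rigid_eqmod_refl.
  have [t [Gt tE tx]] := IHn (ltnW n_lt); set z := c n.+1 in tE.
  have zx : z != x by apply: iter_ordS_neq; rewrite (ltnW n_lt).
  have zSx : ordS z != x by apply: (@iter_ordS_neq n.+2).
  exists (t ^ a z); split=> [|y|].
  - exact: (subgroupJ sgG Gt (Ga z)).
  - rewrite -(letter_actKV (a z) y) letter_actJ tE !gen_actE -permJ tpermJ.
    by rewrite tpermL (tpermD zx zSx).
  have zx' : letter_act (a z) x = x by rewrite gen_actE tpermD.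
  have zxV : letter_act (a z)^-1 x = x by rewrite -{1}zx' letter_actK.
  have -> : letter_section (t ^ a z) x = letter_section t x * a z.
    have sV : letter_section (a z)^-1 x = 1.
      have := letter_sectionV (a z) x; rewrite zx' gen_sectionE.
      by rewrite eq_sym (negPf zx) eq_sym (negPf zSx) invg1.
    by rewrite conjgE !letter_sectionM zxV sV tE tpermL gen_sectionE eqxx mul1g.
  rewrite expgSr; apply: rigid_eqmodM => //; exact: gen_eqmod.
have d_gt1 : 1 < d by apply: leq_trans d_ge3.
have dE : d.-2.+2 = d by rewrite -subn2 -addn2 subnK.
have [|t [Gt tE tx]] := walk d.-2; first by rewrite dE.
set z := c d.-2.+1 in tE.
have zS : ordS z = x.
  suff : c d.-2.+2 = x by [].
  by rewrite dE; apply: iter_ordS_d.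
exists (t * a z); split=> [|y|]; first exact: (subgroupM sgG).
  by rewrite letter_actM tE gen_actE zS tpermC tpermK.
have -> : a x ^+ d = a x ^+ d.-2.+1 * a x by rewrite -expgSr dE.
rewrite letter_sectionM tE tpermL gen_sectionE eqxx.
by apply: rigid_eqmodM => //; apply: gen_eqmod.
Qed.

(** The other sections can be taken to be powers of [g] because [h ^+ (d * m)],
    with [h] from [odd_loop] and [g] equal to [a x ^+ m] modulo rigid sections,
    has powers of [a x ^+ m] as sections modulo rigid sections. *)
Lemma G_level1_tuple_extend x g : G g -> exists2 f, level1_tuple G f &
  f x = g /\ forall y, exists n, f y = g ^+ n.
Proof.
move=> Gg; have [m gm] := G_eqmod_gen x Gg.
have [h [Gh hE hx]] := odd_loop x.
have Gsec y : G (letter_section h y) by apply: G_self_similar.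
have /choice[n nE] y : exists n, letter_section h y ~ a x ^+ n.
  exact: G_eqmod_gen.
have Gh1 : level1_tuple G (letter_section h) by exists h.
exists (fun y => if y == x then g else g ^+ (n y * d)%N); last first.
  split=> [|y]; first by rewrite eqxx.
  by case: (y == x); [exists 1%N; rewrite expg1 | exists (n y * d)%N].
have Gpow p : level1_tuple G (fun y => letter_section h y ^+ p).
  elim: p => [|p IHp]; first exact: level1_tuple1.
  by apply: eq_level1_tuple (level1_tupleM sgG Gh1 IHp) => y; rewrite expgS.
apply: level1_tuple_eqmod (Gpow (d * m)%N) _ => y.
case: eqP => [->|_].
  apply: rigid_eqmod_trans (rigid_eqmodX _ (Gsec x) hx) _.
  apply: rigid_eqmod_trans (rigid_eqmod_sym gm).
  rewrite -expgnA mulnA.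
  (* an odd square is 1 modulo 4 *)
  have -> : (d * d = 1 + 4 * (d./2 * d./2.+1))%N.
    rewrite -{1 2}[d]odd_double_half d_odd -muln2; move: d./2 => q.
    by rewrite mulnDl !mulnDr; lia.
  by rewrite mulnDl mul1n -mulnA; apply: gen_exp_mod4.
apply: rigid_eqmod_trans (rigid_eqmodX _ (Gsec y) (nE y)) _.
rewrite -expgnA mulnA mulnC expgnA.
have Gam : G (a x ^+ m) by apply: (subgroupX sgG); apply: G_gen_in.
exact: rigid_eqmodX _ Gam (rigid_eqmod_sym gm).
Qed.

Lemma G_fractal k x g : level_stab G k g ->
  exists2 h, level_stab G k.+1 h & tree_section h [:: x] = g.
Proof.
case=> Gg gk; have [f [h Gh hf] [fx fE]] := G_level1_tuple_extend x Gg.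
exists h; last by have [_] := hf x; rewrite fx.
split=> // -[|y u] //= [uk]; rewrite letter_sectionE.
have [-> ->] := hf y; have [n ->] := fE y; congr (_ :: _).
elim: n => [|n IHn] //; by rewrite expgS /= gk.
Qed.

Lemma G_level_transitive : level_transitive G.
Proof.
have Gletter x y : exists2 g, G g & letter_act g x = y.
  have [n _ ->] := iter_ordS_surj x y.
  elim: n => [|n [g Gg gn]]; first by exists 1; [apply: subgroup1 sgG|].
  exists (g * a (iter n (@ordS d) x)).
    exact: (subgroupM sgG Gg (G_gen_in _)).
  by rewrite letter_actM gn gen_actE tpermL.
elim=> [|k IHk] [|x u] [|y v] //=; first by exists 1; [apply: subgroup1 sgG|].
move=> [uk] [vk]; have [g Gg gx] := Gletter x y.
have [|h Gh hv] := IHk (letter_section g x u) v _ vk.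
  by rewrite size_tree_aut.
have [|h' [Gh' h'1] h'y] := @G_fractal 0 y h.
  by split=> // -[|? ?] // _; apply: tree_aut_nil.
exists (g * h'); first exact: (subgroupM sgG).
rewrite /= letter_sectionE gx letter_sectionE /letter_section h'y hv.
by have := h'1 [:: y] erefl; rewrite letter_actE => -[->].
Qed.

End TheGroup.

Theorem corollary4p10 (d : nat) (d_ge3 : 3 <= d) (d_odd : odd d) :
  very_strongly_fractal (G_ d).
Proof.
split; first exact: G_subgroup; first exact: G_self_similar.
  exact: G_level_transitive.
move=> k x; apply/seteqP; split=> [_ [h [Gh hk] <-]|g gk]; last first.
  by have [h hk <-] := G_fractal d_ge3 d_odd x gk; exists h.
split=> [|u uk]; first exact: G_self_similar.
have := hk (x :: u); rewrite letter_sectionE /= uk.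
by move=> /(_ erefl)[_].
Qed.
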